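(* Let $G$ be a finite simple graph with $n$ vertices and $m_G$ edges, and let $r$ be a restraint on $G$. Write, for all integers $x\geq M_{G,r}$, $$\pi_r(G,x)=\sum_{i=0}^n (-1)^{n-i}a_i(G,r)x^i .$$ Then $$a_{n-1}(G,r)=m_G+\sum_{u\in V(G)}|r(u)|.$$
   Context: A restraint $r$ on a graph $G$ is a function assigning to each vertex $v$ a finite set $r(v)\subset\mathbb{N}$ of forbidden colours. A proper $x$-colouring $c:V(G)\to\{1,\dots,x\}$ (adjacent vertices get different colours) is permitted by $r$ if $c(v)\notin r(v)$ for every vertex $v$. The restrained chromatic polynomial $\pi_r(G,x)$ is the number of proper $x$-colourings of $G$ permitted by $r$. $M_{G,r}$ denotes the maximum element of $\bigcup_{v\in V(G)}r(v)$ if this set is nonempty, and $0$ otherwise. It is known that for $x\geq M_{G,r}$, $\pi_r(G,x)$ agrees with a monic polynomial of degree $n$ in $x$ with integer coefficients; the $a_i(G,r)$ are defined via this polynomial. *)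

(* Defs.v *)
From HB Require Import structures.
From mathcomp Require Import all_boot all_order all_algebra.
From mathcomp Require Import finmap.

Set Implicit Arguments.
Unset Strict Implicit.
Unset Printing Implicit Defensive.

Definition simple_graph (V : finType) (e : rel V) : Prop :=
  symmetric e /\ irreflexive e.

Definition edges (V : finType) (e : rel V) : {set {set V}} :=
  [set [set p.1; p.2] | p : V * V & e p.1 p.2].

(* Forbidden colours lie in N = {1, 2, ...}: colourings use the colours
   1, ..., x, and a forbidden colour 0 would add to |r v| without ever
   forbidding anything. *)
Definition restraint (V : finType) (r : V -> {fset nat}) : Prop :=
  forall v, 0 \notin r v.

Definition max_forbidden (V : finType) (r : V -> {fset nat}) : nat :=
  \max_(v : V) \max_(k <- r v) k.

(* The colours 1, ..., x are encoded by 'I_x: the ordinal i is colour i.+1. *)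
Definition colour (x : nat) (i : 'I_x) : nat := i.+1.

Definition proper_colouring (V : finType) (e : rel V) (x : nat)
    (c : {ffun V -> 'I_x}) : bool :=
  [forall u, forall v, e u v ==> (c u != c v)].

Definition permitted (V : finType) (r : V -> {fset nat}) (x : nat)
    (c : {ffun V -> 'I_x}) : bool :=
  [forall v, colour (c v) \notin r v].

Definition restrained_chromatic (V : finType) (e : rel V)
    (r : V -> {fset nat}) (x : nat) : nat :=
  #|[set c : {ffun V -> 'I_x} | proper_colouring e c && permitted r c]|.

(* Main.v *)
Require Import Defs.
From HB Require Import structures.
From mathcomp Require Import all_boot all_order all_algebra.
From mathcomp Require Import finmap.
From mathcomp Require Import zify.

Set Implicit Arguments.
Unset Strict Implicit.
Unset Printing Implicit Defensive.

Import GRing.Theory.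
Local Open Scope ring_scope.

Import Order.TTheory Num.Theory.

(** Each edge and each pair (vertex, forbidden colour) is a constraint on the
    [x ^ n] maps from the vertices to the colours, and the permitted proper
    colourings are the maps that violate no constraint.  For [x] large enough
    one constraint is violated by exactly [x ^ (n - 1)] maps, and two distinct
    ones by at most [x ^ (n - 2)].  With [N] constraints, the first two
    Bonferroni inequalities therefore squeeze the count between
    [x ^ n - N x ^ (n - 1)] and [x ^ n - N x ^ (n - 1) + N ^ 2 x ^ (n - 2)],
    which determines the coefficient of [x ^ (n - 1)]. *)

(** * Bonferroni inequalities by double counting *)

Section Bonferroni.
Local Open Scope nat_scope.
Variables (T I : finType) (P : pred I) (B : I -> {set T}).

Let hits (c : T) := [set i | P i & c \in B i].

Lemma cards_sum_mem (A : {set T}) : #|A| = \sum_(c : T) (c \in A).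
Proof. by rewrite -sum1_card big_mkcond; apply: eq_bigr => c _; case: ifP. Qed.

Lemma avoid_hits : [set c | [forall (i | P i), c \notin B i]] =
  [set c | #|hits c| == 0].
Proof.
apply/setP => c; rewrite !inE cards_eq0; apply/forall_inP/eqP => [h|h i Pi].
  by apply/setP => i; rewrite !inE; apply/negP => /andP[Pi]; apply/negP/h.
apply/negP => ci; suff: i \in hits c by rewrite h inE.
by rewrite inE Pi.
Qed.

Lemma card_hits (c : T) : #|hits c| = \sum_(i | P i) (c \in B i).
Proof.
rewrite -sum1_card [RHS]big_mkcond [LHS]big_mkcond.
by apply: eq_bigr => i _; rewrite inE; case: (P i); case: (c \in B i).
Qed.

Lemma sum_card_hits : \sum_(i | P i) #|B i| = \sum_c #|hits c|.
Proof.
under eq_bigr do rewrite cards_sum_mem.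
by rewrite exchange_big; apply: eq_bigr => c _; rewrite card_hits.
Qed.

(** Exchanging the sums, a point [c] lying in [h] of the sets accounts for [h] choices of [i] and
    then [h - 1] choices of [j]. *)
Lemma sum_card_hits2 :
  \sum_(i | P i) \sum_(j | P j && (j != i)) #|B i :&: B j|
    = \sum_c #|hits c| * #|hits c|.-1.
Proof.
transitivity (\sum_(i | P i) \sum_c \sum_(j | P j && (j != i)) (c \in B i :&: B j)).
  apply: eq_bigr => i _; rewrite exchange_big; apply: eq_bigr => j _.
  exact: cards_sum_mem.
rewrite exchange_big; apply: eq_bigr => c _.
rewrite {1}card_hits big_distrl; apply: eq_bigr => i Pi /=.
under eq_bigr do rewrite inE -mulnb.
rewrite -big_distrr /=; case ci: (c \in B i); last by rewrite !mul0n.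
by rewrite card_hits (bigD1 i Pi) /= ci add1n /= !mul1n.
Qed.

Lemma bonferroni1 :
  #|T| <= #|[set c | [forall (i | P i), c \notin B i]]| + \sum_(i | P i) #|B i|.
Proof.
rewrite avoid_hits sum_card_hits cards_sum_mem -big_split -sum1_card /=.
by apply: leq_sum => c _; rewrite inE; case: #|_|.
Qed.

(** Pointwise this is [[h = 0] + h <= 1 + h (h - 1)], where [h] is the number of sets containing
    [c]. Pairs are ordered, so the correction is twice the classical one; only its order of
    magnitude matters later. *)
Lemma bonferroni2 :
  #|[set c | [forall (i | P i), c \notin B i]]| + \sum_(i | P i) #|B i|
   <= #|T| + \sum_(i | P i) \sum_(j | P j && (j != i)) #|B i :&: B j|.
Proof.
rewrite avoid_hits sum_card_hits sum_card_hits2 cards_sum_mem -!big_split.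
rewrite -sum1_card -big_split /=.
by apply: leq_sum => c _; rewrite inE; case: #|_| => [|[|k]] //=; nia.
Qed.

End Bonferroni.

(** * Counting maps with prescribed values *)

Section Recolour.
Local Open Scope nat_scope.
Variables (V T : finType).
Implicit Types (c : {ffun V -> T}) (u v w : V) (a : T).

Definition recolour c u a : {ffun V -> T} :=
  [ffun z => if z == u then a else c z].

Lemma recolour_same c u a : recolour c u a u = a.
Proof. by rewrite ffunE eqxx. Qed.

Lemma recolour_other c u a v : v != u -> recolour c u a v = c v.
Proof. by rewrite ffunE => /negbTE->. Qed.

Lemma recolour_twice c u a b : recolour (recolour c u a) u b = recolour c u b.
Proof. by apply/ffunP => z; rewrite !ffunE; case: eqP. Qed.

Lemma recolour_id c u : recolour c u (c u) = c.
Proof. by apply/ffunP => z; rewrite ffunE; case: eqP => // ->. Qed.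

(** Sending [(c, a)] to [recolour c u a] is a bijection onto [A]: the lost value at [u] is recovered
    as [g c], since [g] ignores the colour of [u]. *)
Lemma card_prescribed (A : {set {ffun V -> T}}) u (g : {ffun V -> T} -> T) :
  (forall c a, (recolour c u a \in A) = (c \in A)) ->
  (forall c a, g (recolour c u a) = g c) ->
  #|[set c in A | c u == g c]| * #|T| = #|A|.
Proof.
move=> stableA indep_g; rewrite -cardsT -cardsX.
pose f (p : {ffun V -> T} * T) := recolour p.1 u p.2.
rewrite -(card_in_imset (f := f)).
  apply: eq_card => c; apply/imsetP/idP => [[[c' a]]|cA].
    by rewrite !inE => /andP[/andP[c'A _] _] ->; rewrite stableA.
  exists (recolour c u (g c), c u); last by rewrite /f recolour_twice recolour_id.
  by rewrite !inE stableA cA recolour_same indep_g eqxx.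
move=> [c1 a1] [c2 a2]; rewrite !inE /f /=.
move=> /andP[/andP[_ /eqP e1] _] /andP[/andP[_ /eqP e2] _] E.
have Ea : a1 = a2 by rewrite -(recolour_same c1 u a1) E recolour_same.
have Eg : g c1 = g c2 by rewrite -(indep_g c1 a1) E indep_g.
rewrite -(recolour_id c1 u) -(recolour_id c2 u) e1 e2 Eg Ea.
by rewrite -(recolour_twice c1 u a1) E recolour_twice.
Qed.

Lemma card_prescribed1 u (g : {ffun V -> T} -> T) :
  (forall c a, g (recolour c u a) = g c) ->
  #|[set c : {ffun V -> T} | c u == g c]| * #|T| = #|T| ^ #|V|.
Proof.
have <- : #|[set: {ffun V -> T}]| = #|T| ^ #|V| by rewrite cardsT card_ffun.
move=> indep_g; rewrite -(card_prescribed (A := setT) _ indep_g).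
  by congr (_ * _); apply: eq_card => c; rewrite !inE.
by move=> c a; rewrite !inE.
Qed.

(** Prescribe [w] first, then [u] inside the resulting set, which is stable under recolouring [u].
    Hence [h] must ignore both vertices, while [g] may depend on the colour of [w]. *)
Lemma card_prescribed2 (S : {set {ffun V -> T}}) u w (g h : {ffun V -> T} -> T) :
  u != w ->
  (forall c a, g (recolour c u a) = g c) ->
  (forall c a, h (recolour c u a) = h c) ->
  (forall c a, h (recolour c w a) = h c) ->
  {in S, forall c, c u = g c /\ c w = h c} ->
  #|S| * #|T| ^ 2 <= #|T| ^ #|V|.
Proof.
move=> neq_uw gu hu hw sub.
pose A := [set c : {ffun V -> T} | c w == h c].
have stA c a : (recolour c u a \in A) = (c \in A).
  by rewrite !inE hu recolour_other // eq_sym.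
rewrite -(card_prescribed1 hw) -/A -(card_prescribed stA gu) -mulnA.
rewrite leq_mul2r; apply/orP; right; apply: subset_leq_card.
by apply/subsetP => c /sub[eu ew]; rewrite !inE eu ew !eqxx.
Qed.

End Recolour.

(** * Integer polynomials of bounded growth *)

(** A nonzero integer leading coefficient has absolute value at least 1, so a degree [l + 1 > d]
    would force [x ^ (l + 1) <= (C + S) x ^ l], with [S] bounding the lower coefficients; this fails
    for large [x]. *)
Lemma size_poly_growth (p : {poly int}) (C d x0 : nat) :
  (forall x : nat, (x0 <= x)%N -> `|p.[x%:Z]| <= C%:Z * x%:Z ^+ d) ->
  (size p <= d.+1)%N.
Proof.
move=> growth; rewrite leqNgt; apply/negP => gt_d.
have [l El] : exists l, size p = l.+2 by case: (size p) gt_d => [|[|l]] // _; exists l.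
have le_dl : (d <= l)%N by lia.
pose S := \sum_(i < l.+1) `|p`_i|.
pose x := (x0 + C + `|S|%N).+1.
have x_ge1 : 1 <= x%:Z :> int by lia.
have S_ge0 : 0 <= S by apply: sumr_ge0.
have rest : `|\sum_(i < l.+1) p`_i * x%:Z ^+ i| <= S * x%:Z ^+ l.
  apply: le_trans (ler_norm_sum _ _ _) _; rewrite mulr_suml; apply: ler_sum => i _.
  rewrite normrM ler_wpM2l ?normr_ge0 // ger0_norm ?exprn_ge0 //.
  by apply: ler_weXn2l => //; rewrite -ltnS.
have small : `|p.[x%:Z]| <= C%:Z * x%:Z ^+ l.
  apply: le_trans (growth _ _) _; first by rewrite /x; lia.
  by rewrite ler_wpM2l // ler_weXn2l.
have lc : 1 <= `|p`_l.+1|.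
  have : lead_coef p != 0 by rewrite lead_coef_eq0 -size_poly_eq0 El.
  by rewrite lead_coefE El /= -normr_gt0; lia.
have top : x%:Z * x%:Z ^+ l <= `|p`_l.+1 * x%:Z ^+ l.+1|.
  by rewrite normrM (ger0_norm (exprn_ge0 _ _)) // -exprS ler_peMl ?exprn_ge0.
have := horner_coef p x%:Z; rewrite El big_ord_recr /= => E.
have tri : `|p`_l.+1 * x%:Z ^+ l.+1| <= (C%:Z + S) * x%:Z ^+ l.
  rewrite mulrDl; apply: le_trans (lerD small rest).
  by apply: le_trans (ler_normB _ _); rewrite E addrAC subrr add0r.
have : x%:Z <= C%:Z + S.
  by rewrite -(ler_pM2r (x := x%:Z ^+ l)) ?(le_trans top) // exprn_gt0 //; lia.
rewrite /x; lia.
Qed.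

(** * Edges and forbidden colours as constraints *)

Section BadEvents.
Local Open Scope nat_scope.
Variables (V : finType) (e : rel V) (r : V -> {fset nat}) (x : nat).
Hypotheses (graph_e : simple_graph e) (restraint_r : restraint r).
Hypothesis le_x : max_forbidden r <= x.

Local Notation constraint := ({set V} + V * 'I_x)%type.

Definition active (i : constraint) : bool :=
  match i with
  | inl E => E \in edges e
  | inr (v, k) => colour k \in r v
  end.

(** Violating an edge means being constant on it as a set, so no order of its endpoints has to be
    chosen. *)
Definition violators (i : constraint) : {set {ffun V -> 'I_x}} :=
  match i with
  | inl E => [set c : {ffun V -> 'I_x} | [forall u in E, forall v in E, c u == c v]]
  | inr (v, k) => [set c : {ffun V -> 'I_x} | c v == k]
  end.

Lemma edgeP (E : {set V}) :
  reflect (exists u v, [/\ u != v, e u v & E = [set u; v]]) (E \in edges e).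
Proof.
case: graph_e => _ irr.
apply: (iffP imsetP) => [[[u v]]|[u [v [_ euv ->]]]]; last by exists (u, v); rewrite ?inE.
rewrite inE /= => euv ->; exists u, v; split=> //.
by apply: contraTneq euv => ->; rewrite irr.
Qed.

Lemma violators_edge (u v : V) :
  violators (inl [set u; v]) = [set c : {ffun V -> 'I_x} | c u == c v].
Proof.
apply/setP => c; rewrite !inE; apply/forall_inP/eqP => [h|h a].
  by have /forall_inP/(_ v) := h u (set21 u v); rewrite set22 => /(_ isT)/eqP.
by rewrite !inE => /orP[]/eqP-> ; apply/forall_inP => b; rewrite !inE => /orP[]/eqP->;
  rewrite ?h.
Qed.

Lemma restrained_chromatic_violators :
  restrained_chromatic e r x =
  #|[set c | [forall (i | active i), c \notin violators i]]|.
Proof.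
apply: eq_card => c; rewrite !inE; apply/andP/forall_inP.
  move=> [/forallP prop /forallP perm] [E /edgeP[u [v [_ euv ->]]]|[v k] /= kr].
    by rewrite violators_edge inE; move/forallP: (prop u) => /(_ v)/implyP/(_ euv).
  by rewrite inE; apply: contraNneq (perm v) => ->.
move=> h; split; apply/forallP => u.
  apply/forallP => v; apply/implyP => euv.
  have act : active (inl [set u; v]) by apply/imsetP; exists (u, v); rewrite ?inE.
  by have := h _ act; rewrite violators_edge inE.
by apply/negP => ur; have := h (inr (u, c u)) ur; rewrite inE eqxx.
Qed.

Lemma card_violators (i : constraint) : active i -> #|violators i| * x = x ^ #|V|.
Proof.
rewrite -[x in _ * x]card_ord -[x in RHS]card_ord.
case: i => [E /edgeP[u [v [uv _ ->]]]|[v k] _].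
  rewrite violators_edge; apply: card_prescribed1 => c a.
  by rewrite recolour_other // eq_sym.
exact: card_prescribed1.
Qed.

(* Multiplying by [x ^ 2] keeps the bound meaningful when there is a single
   vertex, where the intersection is empty. *)
Lemma card_violatorsI (i j : constraint) : active i -> active j -> j != i ->
  #|violators i :&: violators j| * x ^ 2 <= x ^ #|V|.
Proof.
have edge_pair u v w k : u != v ->
    #|violators (inl [set u; v]) :&: violators (inr (w, k))| * x ^ 2 <= x ^ #|V|.
  (* Some endpoint differs from [w]; its colour is copied from the other endpoint, which may be [w]
     itself. *)
  wlog uw : u v / u != w => [hw uv|uv].
    case: (eqVneq u w) => [Euw|]; last by move/hw; apply.
    by rewrite setUC; apply: hw; rewrite -?Euw eq_sym.
  rewrite -[x in _ * x ^ 2]card_ord -[x in x ^ #|V|]card_ord.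
  apply: (card_prescribed2 (u := u) (w := w) (g := fun c => c v) (h := fun=> k)) => //.
    by move=> c a; rewrite recolour_other // eq_sym.
  by move=> c; rewrite violators_edge !inE => /andP[/eqP-> /eqP->].
case: i => [E|[w k]]; case: j => [E'|[w' k']].
- move=> /edgeP[u [v [uv _ EE]]] /edgeP[u' [v' [uv' _ EE']]] neq.
  have {}neq : E' != E by apply: contraNneq neq => ->.
  have cE : #|E| = 2 by rewrite EE cards2 uv.
  have cE' : #|E'| = 2 by rewrite EE' cards2 uv'.
  (* Two distinct edges have free endpoints: [u] lies outside the second edge,
     and [u'] is an endpoint of the second edge other than the neighbour [v]
     that determines the colour of [u]. *)
  wlog uE' : u v uv EE / u \notin E' => [hw|].
    have [uE'|] := boolP (u \in E'); last exact: (hw u v).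
    have [vE'|] := boolP (v \in E'); last by apply: (hw v u); rewrite 1?eq_sym // setUC.
    case/negP: neq; rewrite eq_sym eqEcard cE cE' leqnn andbT EE.
    by apply/subsetP => z; rewrite !inE => /orP[]/eqP->.
  wlog vw : u' v' uv' EE' / u' != v => [hw|].
    have [Euv|] := eqVneq u' v; last exact: (hw u' v').
    by apply: (hw v' u'); rewrite 1?eq_sym // 1?setUC // -Euv.
  move: uE'; rewrite EE' !inE negb_or => /andP[uu' uv''].
  rewrite -[x in _ * x ^ 2]card_ord -[x in x ^ #|V|]card_ord.
  apply: (card_prescribed2 (u := u) (w := u') (g := fun c => c v) (h := fun c => c v')) => //.
  + by move=> c a; rewrite recolour_other // eq_sym.
  + by move=> c a; rewrite recolour_other // eq_sym.
  + by move=> c a; rewrite recolour_other // eq_sym.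
  + by move=> c; rewrite EE !violators_edge !inE => /andP[/eqP-> /eqP->].
- by move=> /edgeP[u [v [uv _ ->]]] _ _; apply: edge_pair.
- by move=> _ /edgeP[u [v [uv _ ->]]] _; rewrite setIC; apply: edge_pair.
- move=> _ _ neq; have [Ew|nw] := eqVneq w w'.
    rewrite (_ : _ :&: _ = set0) ?cards0 //; apply/setP => c; rewrite !inE Ew.
    by apply/negP => /andP[/eqP Ek /eqP Ek']; rewrite Ew -Ek -Ek' eqxx in neq.
  rewrite -[x in _ * x ^ 2]card_ord -[x in x ^ #|V|]card_ord.
  apply: (card_prescribed2 (u := w) (w := w') (g := fun=> k) (h := fun=> k')) => //.
  by move=> c; rewrite !inE => /andP[/eqP-> /eqP->].
Qed.

(** No forbidden colour is lost: each is positive and at most [x], hence of the form [colour k]. *)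
Lemma card_forbidden (v : V) : #|[set k : 'I_x | colour k \in r v]| = #|` r v|.
Proof.
have inj : injective (@colour x) by move=> a b [/val_inj].
rewrite cardE -(size_map (@colour x)); apply: perm_size; apply: uniq_perm.
- by rewrite map_inj_uniq ?enum_uniq.
- exact: fset_uniq.
move=> k; apply/mapP/idP => [[i]|kr]; first by rewrite mem_enum inE => ? ->.
have k_gt0 : 0 < k by rewrite lt0n; apply: contraNneq (restraint_r v) => <-.
have k_le : k <= x.
  apply: leq_trans le_x; rewrite /max_forbidden.
  apply: leq_trans (leq_bigmax v).
  exact: (leq_bigmax_seq (F := id)).
have lt_k : k.-1 < x by rewrite prednK.
by exists (Ordinal lt_k); rewrite ?mem_enum ?inE /colour /= prednK.
Qed.

Lemma card_active : \sum_(i | active i) 1 = #|edges e| + \sum_(u : V) #|` r u|.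
Proof.
rewrite big_sumType /= sum1_card; congr (_ + _).
under [RHS]eq_bigr => u _ do rewrite -card_forbidden -sum1_card big_mkcond.
rewrite pair_big big_mkcond /=.
by apply: eq_bigr => -[v k] _; rewrite inE.
Qed.

Lemma restrained_chromatic_lower :
  let N := #|edges e| + \sum_(u : V) #|` r u| in
  x * x ^ #|V| <= x * restrained_chromatic e r x + N * x ^ #|V|.
Proof.
rewrite /= -card_active restrained_chromatic_violators.
have := bonferroni1 active violators; rewrite card_ffun card_ord => b.
apply: (leq_trans (leq_mul (leqnn x) b)); rewrite mulnDr leq_add2l mulnC !big_distrl /=.
by apply: leq_sum => i /card_violators->; rewrite mul1n.
Qed.

Lemma restrained_chromatic_upper :
  let N := #|edges e| + \sum_(u : V) #|` r u| in
  x ^ 2 * restrained_chromatic e r x + x * N * x ^ #|V|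
    <= x ^ 2 * x ^ #|V| + N ^ 2 * x ^ #|V|.
Proof.
rewrite /= -card_active restrained_chromatic_violators.
have := bonferroni2 active violators; rewrite card_ffun card_ord => b.
have S1 : (\sum_(i | active i) #|violators i|) * x = (\sum_(i | active i) 1) * x ^ #|V|.
  by rewrite !big_distrl /=; apply: eq_bigr => i /card_violators->; rewrite mul1n.
have S2 : (\sum_(i | active i) \sum_(j | active j && (j != i))
     #|violators i :&: violators j|) * x ^ 2 <= (\sum_(i | active i) 1) ^ 2 * x ^ #|V|.
  rewrite big_distrl /= -mulnn -mulnA big_distrl; apply: leq_sum => i acti /=.
  (* The bound [N ^ 2] also counts the diagonal [j = i], which is split off and dropped. *)
  rewrite mul1n !big_distrl [leqRHS](bigID (fun j => j != i)) /=.
  apply: leq_trans (leq_addr _ _); apply: leq_sum => j /andP[actj ji].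
  by rewrite mul1n card_violatorsI.
move: (leq_mul (leqnn (x ^ 2)) b) S1 S2; move: (\sum_(i | _) \sum_(j | _) _) => s2.
move: (\sum_(i | _) #|_|) (\sum_(i | _) 1) (x ^ #|V|) #|_| => s1 N X p {b}.
rewrite -!mulnn; nia.
Qed.

End BadEvents.

(** * Extraction of the coefficient *)

Theorem theorem3p1 (V : finType) (e : rel V) (r : V -> {fset nat})
  (n : nat) (a : nat -> int)
  (graph_e : simple_graph e)
  (card_V : #|V| = n)
  (n_gt0 : (0 < n)%N)
  (restraint_r : restraint r)
  (expansion : forall x : nat, (max_forbidden r <= x)%N ->
     (restrained_chromatic e r x)%:Z
       = \sum_(i < n.+1) (-1) ^+ (n - i)%N * a i * x%:Z ^+ i) :
  a n.-1 = (#|edges e| + \sum_(u : V) #|` r u|)%N%:Z.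
Proof.
set N := (_ + _)%N.
pose q : {poly int} := \poly_(i < n.+1) ((-1) ^+ (n - i)%N * a i).
(* The squeeze gives [0 <= p(x) <= N ^ 2 x ^ n]; the factor ['X^2] avoids the exponent [n - 2],
   which is negative for [n = 1]. *)
pose p := (q - 'X^n + N%:Z *: 'X^(n.-1)) * 'X^2.
have En : n = n.-1.+1 by rewrite prednK.
have size_p : (size p <= n.+1)%N.
  apply: (@size_poly_growth p (N ^ 2) n (max_forbidden r)) => x le_x.
  have q_x : q.[x%:Z] = (restrained_chromatic e r x)%:Z.
    by rewrite horner_poly expansion.
  have lo := restrained_chromatic_lower graph_e restraint_r le_x.
  have up := restrained_chromatic_upper graph_e restraint_r le_x.
  rewrite /= -/N card_V En expnS in lo up.
  rewrite /p !hornerE q_x /= [in _ ^+ n]En !exprS.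
  have -> : x%:Z ^+ n.-1 = (x ^ n.-1)%N%:Z by rewrite -[RHS]natz natrX natz.
  move: lo up; move: (restrained_chromatic _ _ _) (x ^ n.-1)%N => t X; rewrite -!mulnn.
  nia.
(* This coefficient is that of ['X^(n.-1)] before the shift by ['X^2], namely [N - a n.-1]. *)
have : p`_n.+1 = 0 by apply: nth_default.
rewrite /p coefMXn /= subSS subn1 !coefE ifF ?ifT ?eqxx; [|by lia|by lia].
have -> : (n - n.-1)%N = 1%N by lia.
have -> : (n.-1 == n) = false by lia.
by rewrite expr1; lia.
Qed.
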